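(* Let $G=(V,E)$ be a finite connected graph and let $\Gamma$ be the family of spanning trees of $G$. Assume that $\mu\in\mathcal{P}(\Gamma)$ has the property that for every $e\in E$ there is $\gamma\in\Gamma$ with $\mu(\gamma)>0$ and $e\in\gamma$. Then there is $\beta\in\mathcal{P}_+(E)$ such that $\mu\in\mathcal{U}_\beta$. In particular, any such graph $G$ is $\beta$-homogeneous if we let $\beta(e)$ be proportional to $\mathcal{R}_{\mathrm{eff}}(e)$, where $\mathcal{R}_{\mathrm{eff}}(e)$ is the effective resistance of the edge $e$, and $\beta\in\mathcal{P}(E)$.
   Context: $G=(V,E)$ is a finite connected undirected graph with at least one edge; multi-edges are allowed, self-loops are not. $\mathcal{P}(X)$ is the set of probability mass functions (pmfs) on a finite set $X$, and $\mathcal{P}_+(X)$ the set of strictly positive ones. $\mathcal{N}(\gamma,e)=1$ if $e\in\gamma$ and $0$ otherwise. For $\beta\in\mathcal{P}_+(E)$, $$\mathcal{U}_\beta=\Big\{u\in\mathbb{R}^\Gamma_{\ge0}:\sum_{\gamma\in\Gamma}\mathcal{N}(\gamma,e)u(\gamma)=(|V|-1)u(\Gamma)\beta(e)\ \text{for all } e\in E\Big\},\quad u(\Gamma)=\sum_{\gamma\in\Gamma}u(\gamma).$$ For $\mu\in\mathcal{P}(\Gamma)$, $\eta_\mu(e)=\sum_{\gamma}\mathcal{N}(\gamma,e)\mu(\gamma)$. $G$ is $\beta$-homogeneous if there exists $\mu\in\mathcal{P}(\Gamma)$ with $\eta_\mu(e)/(|V|-1)=\beta(e)$ for all $e\in E$.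 The effective resistance $\mathcal{R}_{\mathrm{eff}}(e)$ of $e=\{x,y\}$ is the effective resistance between $x$ and $y$ in the electrical network on $G$ with every edge having unit conductance. *)

(* Defs.v *)
From HB Require Import structures.
From mathcomp Require Import all_boot all_order all_algebra.
From mathcomp Require Import boolp classical_sets reals.

Set Implicit Arguments.
Unset Strict Implicit.
Unset Printing Implicit Defensive.

Import Order.TTheory GRing.Theory Num.Theory.

Local Open Scope ring_scope.

(* Finite loopless multigraphs. The order of the two endpoints of an edge is an
   arbitrary labelling: incidence is only read through the symmetric predicate
   [joins]. Parallel edges are distinct elements of [edge] with the same
   endpoints. *)
Record multigraph := Multigraph {
  vertex : finType;
  edge : finType;
  end1 : edge -> vertex;
  end2 : edge -> vertex;
  loopless : forall e, end1 e != end2 e }.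

Definition joins (G : multigraph) (e : edge G) (x y : vertex G) : bool :=
  ((end1 e == x) && (end2 e == y)) || ((end1 e == y) && (end2 e == x)).

Definition adj (G : multigraph) (A : {set edge G}) : rel (vertex G) :=
  fun x y => [exists e in A, joins e x y].

Definition connected_by (G : multigraph) (A : {set edge G}) : Prop :=
  forall x y : vertex G, connect (adj A) x y.

Definition connected_graph (G : multigraph) : Prop :=
  connected_by [set: edge G].

(* The list (v_0, e_0), ..., (v_{k-1}, e_{k-1}) encodes the closed walk
   v_0 e_0 v_1 ... v_{k-1} e_{k-1} v_0. Distinctness of the edges matters only
   for k = 2: two parallel edges form a cycle, one edge used twice does not. *)
Definition is_cycle (G : multigraph) (c : seq (vertex G * edge G)) : bool :=
  [&& c != [::], uniq (map fst c), uniq (map snd c)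
    & cycle (fun s t => joins s.2 s.1 t.1) c].

Definition acyclic (G : multigraph) (A : {set edge G}) : Prop :=
  forall c : seq (vertex G * edge G),
    {subset map snd c <= A} -> ~ is_cycle c.

Definition is_spanning_tree (G : multigraph) (A : {set edge G}) : Prop :=
  connected_by A /\ acyclic A.

Definition spanning_tree (G : multigraph) : finType :=
  {A : {set edge G} | `[< is_spanning_tree A >]}.

Section Modulus.
Variable R : realType.

Definition pmf (X : finType) (p : X -> R) : Prop :=
  (forall x, 0 <= p x) /\ \sum_x p x = 1.

Definition positive_pmf (X : finType) (p : X -> R) : Prop :=
  pmf p /\ forall x, 0 < p x.

Variable G : multigraph.
Implicit Types (u mu : spanning_tree G -> R) (beta : edge G -> R).

Definition usage (t : spanning_tree G) (e : edge G) : R := (e \in val t)%:R.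

Definition in_U beta u : Prop :=
  (forall t, 0 <= u t) /\
  (forall e, \sum_t usage t e * u t =
             (#|vertex G|%:R - 1) * (\sum_t u t) * beta e).

Definition eta mu (e : edge G) : R := \sum_t usage t e * mu t.

Definition homogeneous beta : Prop :=
  exists mu, pmf mu /\ forall e, eta mu e / (#|vertex G|%:R - 1) = beta e.

(* With unit conductances, Ohm's law gives current v z - v w along each edge
   from z to w. *)
Definition net_current_out (v : vertex G -> R) (z : vertex G) : R :=
  \sum_w \sum_(e | joins e z w) (v z - v w).

Definition unit_current_voltage (x y : vertex G) (v : vertex G -> R) : Prop :=
  forall z, net_current_out v z = (z == x)%:R - (z == y)%:R.

(* The voltage drop between x and y when a unit current enters at x and leaves
   at y. If G is connected such a voltage exists and is unique up to an additive
   constant, so neither the choice made by [xget] nor its default matters. *)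
Definition effective_resistance (x y : vertex G) : R :=
  let v := xget (fun=> 0) [set v | unit_current_voltage x y v]%classic in
  v x - v y.

(* Symmetric in the endpoints, as reversing the current negates the voltage. *)
Definition Reff (e : edge G) : R := effective_resistance (end1 e) (end2 e).

End Modulus.

Definition proportional (R : realType) (X : Type) (f g : X -> R) : Prop :=
  exists c : R, forall x, f x = c * g x.

(* Main.v *)
Require Import Defs.
From HB Require Import structures.
From mathcomp Require Import all_boot all_order all_algebra.
From mathcomp Require Import boolp classical_sets reals.
From mathcomp Require Import ring.

Set Implicit Arguments.
Unset Strict Implicit.
Unset Printing Implicit Defensive.

Import Order.TTheory GRing.Theory Num.Theory.

Local Open Scope ring_scope.

(** Every spanning tree has [#|vertex G| - 1] edges ([card_spanning_tree]), so
    summing the edge usage [eta mu e] over all edges [e] counts each tree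
    [#|vertex G| - 1] times ([sum_eta]). Hence [eta mu / (#|vertex G| - 1)] is a
    pmf on the edges. It is positive as soon as the support of [mu] covers every
    edge, and [mu] lies in the corresponding set [in_U]. It remains to find a pmf
    [mu] with [eta mu = Reff]; by Kirchhoff's theorem ([kirchhoff_Reff]) the
    uniform pmf on the spanning trees is one. Any pmf proportional to [Reff] is
    then equal to [eta mu / (#|vertex G| - 1)], because both have total mass 1.

    Kirchhoff's theorem is obtained by exhibiting the voltage of the unit current
    from [x] to [y]. Its value at [z] is, up to division by the number of
    spanning trees, the number of two-component spanning forests that separate
    [x] from [y] and put [z] on the side of [x]. A two-component forest whose
    components are joined by an edge [f] is the same thing as a spanning tree
    [T] containing [f], with [f] removed; so the voltage drop along [f] is a sum
    over the spanning trees [T] through [f] ([forest_voltage_drop]). For a fixed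
    [T] the summand is the signed passage through [f] of the path from [x] to
    [y] in [T], which is a unit flow ([tree_flow]); averaging over [T] gives
    Kirchhoff's current law ([forest_voltage_unit_current]). When [x] and [y]
    are the ends of [e], the drop along [e] itself is the proportion of spanning
    trees containing [e]. Voltages are unique up to a constant
    ([harmonic_constant]), so this drop is the effective resistance. *)

(** * Connectivity, bridges and spanning trees *)

Section Trees.
Variable G : multigraph.
Implicit Types (A F T : {set edge G}) (e f g : edge G) (x y z : vertex G).

Lemma joinsC e x y : joins e x y = joins e y x.
Proof. by rewrite /joins orbC. Qed.

Lemma joins_ends e : joins e (end1 e) (end2 e).
Proof. by rewrite /joins !eqxx. Qed.

Lemma joinsP e x y :
  reflect ((x, y) = (end1 e, end2 e) \/ (y, x) = (end1 e, end2 e))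
          (joins e x y).
Proof.
apply: (iffP orP) => [[]/andP[/eqP<- /eqP<-]|[][-> ->]]; rewrite ?eqxx; auto.
Qed.

Lemma connect_adjC A x y : connect (adj A) x y = connect (adj A) y x.
Proof.
apply: sym_connect_sym => {}x {}y.
by apply: eq_existsb => e; rewrite joinsC.
Qed.

Lemma connect_joins A e x y : e \in A -> joins e x y -> connect (adj A) x y.
Proof. by move=> eA exy; apply/connect1/existsP; exists e; rewrite eA. Qed.

Lemma connect_ends A e : e \in A -> connect (adj A) (end1 e) (end2 e).
Proof. by move=> eA; exact: connect_joins eA (joins_ends e). Qed.

Lemma connect_endsr A e x :
  e \in A -> connect (adj A) x (end1 e) = connect (adj A) x (end2 e).
Proof.
move=> eA; apply: same_connect_r (connect_ends eA) x => y z.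
exact: connect_adjC.
Qed.

Lemma connect_subset A F x y :
  A \subset F -> connect (adj A) x y -> connect (adj F) x y.
Proof.
move=> AF; apply: connect_sub x y => x y /existsP[e /andP[eA exy]].
exact: connect_joins (fintype.subsetP AF e eA) exy.
Qed.

(** A function of the vertices that agrees at the two ends of every edge of [A]
    is constant on the components of [A]. Applied to
    a well-chosen function, it replaces an induction along a path. *)
Lemma connect_invariant (X : Type) (h : vertex G -> X) A x y :
  (forall e, e \in A -> h (end1 e) = h (end2 e)) ->
  connect (adj A) x y -> h x = h y.
Proof.
move=> hA /connectP[p]; elim: p x => [|w p IH] x /=; first by move=> _ ->.
case/andP=> /existsP[e /andP[eA /joinsP exw]] wp yp; rewrite -(IH w wp yp).
by case: exw => -[-> ->]; rewrite hA.
Qed.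

(** The ends of each edge of [A] are disconnected in [A] by deleting that edge.
    This is acyclicity in a form that does not mention closed walks. *)
Definition all_bridges A :=
  forall e, e \in A -> ~~ connect (adj (A :\ e)) (end1 e) (end2 e).

(** A simple path, followed by an edge [e] from its last vertex to [z], as a list
    in the format of [is_cycle]; for [z = x] the list is a cycle. The third clause
    records where the edges come from: it is what makes them pairwise distinct,
    since an edge leaving [x] cannot have both ends among the later vertices. *)
Lemma path_to_cycle A e x p z :
  path (adj A) x p -> uniq (x :: p) -> e \notin A -> joins e (last x p) z ->
  exists c : seq (vertex G * edge G),
    [/\ map fst c = x :: p, uniq (map snd c),
        {in map snd c, forall f, f = e \/
           [/\ f \in A, end1 f \in x :: p & end2 f \in x :: p]},
        path (fun s t => joins s.2 s.1 t.1) (head (x, e) c) (behead c)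
      & joins (last (x, e) c).2 (last (x, e) c).1 z].
Proof.
elim: p x => [|w p IH] x /=.
  move=> _ _ eA ez; exists [:: (x, e)]; split=> //= f.
  by rewrite inE => /eqP; left.
case/andP=> /existsP[f /andP[fA fxw]] wp /andP[xwp uwp] eA ez.
have [c [cV cU cE cP cL]] := IH w wp uwp eA ez.
case: c cV cU cE cP cL => [|[w' e'] c] // [-> cV] cU cE cP cL.
exists ((x, f) :: (w, e') :: c); split.
- by rewrite /= cV.
- rewrite /= in cU *; rewrite cU andbT.
  apply/negP => /cE[fe|[_ f1 f2]]; first by rewrite -fe fA in eA.
  by case/joinsP: fxw => -[xE wE]; rewrite -?xE -?wE in f1 f2;
     rewrite ?f1 ?f2 in xwp.
- move=> g; rewrite map_cons [_ \in _ :: _]inE.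
  case/predU1P=> [->|/cE[->|[gA g1 g2]]].
  + right; split=> //=; case/joinsP: fxw => -[-> ->];
    by rewrite !inE eqxx ?orbT.
  + by left.
  + by right; split; rewrite // inE ?g1 ?g2 orbT.
- by rewrite /= fxw.
- exact: cL.
Qed.

Lemma acyclic_all_bridges A : acyclic A -> all_bridges A.
Proof.
move=> acA e eA; apply/negP => /connectP[p0 p0P p0L].
move: p0L; case: (shortenP p0P) => p pP pU _ pL.
have e_last : joins e (last (end1 e) p) (end1 e).
  by rewrite -pL joinsC joins_ends.
have eNA : e \notin A :\ e by rewrite !inE eqxx.
have [c [cV cU cE cP cL]] := path_to_cycle pP pU eNA e_last.
apply: (acA c).
  by move=> f /cE[-> //|[]]; rewrite inE => /andP[].
case: c cV cU cE cP cL => [|[w e'] c] // cV cU _ cP cL.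
rewrite /is_cycle cV cU pU /=; case: cV cP cL => -> _ /= cP cL.
by rewrite rcons_path cP.
Qed.

Lemma all_bridges_acyclic A : all_bridges A -> acyclic A.
Proof.
move=> brA [|[x e] c] // cA /and4P[_ _ /= /andP[ec _] cP].
(* The cycle without its first edge [e] is a walk between the ends of [e]. *)
have walk s q (z : vertex G * edge G) : {subset map snd (s :: q) <= A :\ e} ->
    path (fun s t => joins s.2 s.1 t.1) s (rcons q z) ->
    connect (adj (A :\ e)) s.1 z.1.
  elim: q s => [|t q IH] s sA /=.
    by rewrite andbT; apply: connect_joins; apply: sA; rewrite inE eqxx.
  case/andP=> st tz; apply: (@connect_trans _ _ t.1).
    by apply: connect_joins st; apply: sA; rewrite inE eqxx.
  by apply: IH => // f fq; apply: sA; rewrite inE fq orbT.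
have eA : e \in A by apply: cA; rewrite inE eqxx.
(* A cycle of length 1 would be a loop. *)
have := brA e eA; case: c cA ec cP => [|s c] cA ec.
  rewrite /= andbT => /joinsP[][xe xe'];
  by have := loopless e; rewrite -xe -xe' eqxx.
rewrite rcons_cons [path _ _ _]/= => /andP[exs sP] /negP; apply.
have sx : connect (adj (A :\ e)) s.1 x.
  apply: (walk s c (x, e)) => // f fc; rewrite !inE; apply/andP; split.
    by apply: contraNneq ec => <-.
  by apply: cA; rewrite inE fc orbT.
case/joinsP: exs => -[<- <-] //.
by rewrite connect_adjC.
Qed.

Lemma is_spanning_treeP A :
  is_spanning_tree A <-> connected_by A /\ all_bridges A.
Proof.
split=> -[cA HA]; split=> //; first exact: acyclic_all_bridges.
exact: all_bridges_acyclic.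
Qed.

Lemma connected_by_ends A F :
  connected_by A ->
  (forall e, e \in A -> connect (adj F) (end1 e) (end2 e)) -> connected_by F.
Proof.
move=> cA cF x y.
suff <- : connect (adj F) x x = connect (adj F) x y by exact: connect0.
apply: connect_invariant (cA x y) => e /cF ce.
by apply: same_connect_r ce x => u v; exact: connect_adjC.
Qed.

Lemma spanning_tree_inside A :
  connected_by A -> exists2 T : {set edge G}, T \subset A & is_spanning_tree T.
Proof.
have [n] := ubnP #|A|; elim: n A => // n IH A nA cA.
have [e /andP[eA ce]|br] :=
    pickP [pred e in A | connect (adj (A :\ e)) (end1 e) (end2 e)].
  have [||T TA tT] := IH (A :\ e); last first.
  - by exists T => //; apply: fintype.subset_trans TA (finset.subsetDl _ _).
  - apply: connected_by_ends cA _ => f fA.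
    by have [-> //|fe] := eqVneq f e; apply: connect_ends; rewrite !inE fe.
  - by move: nA; rewrite (cardsD1 e) eA.
exists A => //; apply/is_spanning_treeP; split=> // e eA.
by have := br e; rewrite inE eA /= => ->.
Qed.

(** If adding [f] to [F] makes it connected, then every vertex lies in the
    component, in [F], of one of the ends of [f]. *)
Lemma two_components F f z :
  connected_by (f |: F) ->
  connect (adj F) (end1 f) z || connect (adj F) (end2 f) z.
Proof.
move=> cT; pose h w := connect (adj F) (end1 f) w || connect (adj F) (end2 f) w.
rewrite -/(h z); suff <- : h (end1 f) = h z by rewrite /h connect0.
apply: connect_invariant (cT _ _) => g.
rewrite finset.in_setU1 => /predU1P[->|gF].
  by rewrite /h !connect0 orbT.
by rewrite /h !(connect_endsr _ gF).
Qed.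

End Trees.

(** * The unit flow carried by a spanning tree *)

Section Flow.
Variables (R : comNzRingType) (G : multigraph).
Implicit Types (A F T : {set edge G}) (e f g : edge G) (x y z : vertex G).

(** The signed incidence matrix: each edge [e] is oriented from [end1 e] to
    [end2 e]. The orientation is immaterial: in the expression of a flow,
    [incidence] is multiplied by a quantity that changes sign with it. *)
Definition incidence z e : R := (end1 e == z)%:R - (end2 e == z)%:R.

Lemma sum_incidence (h : vertex G -> R) e :
  \sum_z incidence z e * h z = h (end1 e) - h (end2 e).
Proof.
have sumE w : \sum_z (w == z)%:R * h z = h w.
  rewrite (bigD1 w) //= eqxx mul1r big1 ?addr0 // => z.
  by rewrite eq_sym => /negPf->; rewrite mul0r.
under eq_bigr do rewrite mulrBl.
by rewrite sumrB !sumE.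
Qed.

(** The indicator of the component of [end1 f] in [T] deprived of [f]. For a
    spanning tree [T] containing [f], the difference [side T f x - side T f y]
    is 1, -1 or 0 according as the path from [x] to [y] in [T] crosses [f]
    forwards, backwards or not at all. *)
Definition side T f z : R := (connect (adj (T :\ f)) (end1 f) z)%:R.

(** The functions [side T f], for [f] in [T], are dual to the edges of [T]. *)
Lemma side_drop T f g :
  is_spanning_tree T -> f \in T -> g \in T ->
  side T f (end1 g) - side T f (end2 g) = (f == g)%:R.
Proof.
case/is_spanning_treeP=> _ brT fT gT; rewrite /side.
have [<-|fg] := eqVneq f g; first by rewrite connect0 (negPf (brT f fT)) subr0.
apply/eqP; rewrite subr_eq0; apply/eqP; congr (_ %:R); congr nat_of_bool.
by apply: connect_endsr; rewrite !inE eq_sym fg.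
Qed.

(** The path from [x] to [y] in [T] is a unit flow. By duality the two members,
    as functions of [x], have the same variation along each edge of [T]; hence
    their difference is constant in [x], as [T] is connected, and it vanishes
    at [y]. *)
Lemma tree_flow T x y z :
  is_spanning_tree T ->
  \sum_(f in T) incidence z f * (side T f x - side T f y)
    = (x == z)%:R - (y == z)%:R.
Proof.
move=> tT; have [cT _] := tT.
pose h w := \sum_(f in T) incidence z f * side T f w - (w == z)%:R.
suff /eqP : h x = h y.
  under eq_bigr do rewrite mulrBr.
  rewrite sumrB -subr_eq0 => /eqP hxy; apply/eqP.
  by rewrite -subr_eq0 -[X in _ == X]hxy /h; apply/eqP; ring.
apply: connect_invariant (cT x y) => g gT; apply/eqP; rewrite -subr_eq0.
have -> : h (end1 g) - h (end2 g) =
    \sum_(f in T) incidence z f * (side T f (end1 g) - side T f (end2 g))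
    - incidence z g.
  under [X in _ = X - _]eq_bigr do rewrite mulrBr.
  by rewrite sumrB /h /incidence; ring.
rewrite (bigD1 g) //= side_drop // eqxx mulr1 big1 ?addr0 ?subrr // => f.
by case/andP=> fT /negPf fg; rewrite side_drop // fg mulr0.
Qed.

End Flow.

Arguments incidence R {G} z e.
Arguments side R {G} T f z.

(** * Number of edges and the exchange property *)

Section TreeCount.
Variable G : multigraph.
Implicit Types (A F T : {set edge G}) (e f g : edge G) (x y z : vertex G).

(** The sum over [z] of the flow out of [z] along the path from [z] to [x0] in
    [T] is computed in two ways: [tree_flow] gives [#|vertex G| - 1], and
    [side_drop] gives 1 for each edge of [T]. The vertex [x0] also witnesses
    that the graph is not empty. *)
Lemma card_spanning_tree T x0 : is_spanning_tree T -> #|T|.+1 = #|vertex G|.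
Proof.
move=> tT; apply/eqP; rewrite -(eqr_nat rat) -natr1 eq_sym -subr_eq.
have <- : \sum_z \sum_(f in T)
    incidence rat z f * (side rat T f z - side rat T f x0) = #|vertex G|%:R - 1.
  under eq_bigr do rewrite tree_flow //.
  rewrite sumrB (bigD1 x0 (F := fun z => (x0 == z)%:R)) //= eqxx.
  rewrite [X in _ - (1 + X)]big1 => [|z /negPf]; last by rewrite eq_sym => ->.
  by rewrite addr0; under eq_bigr do rewrite eqxx; rewrite sumr_const.
rewrite exchange_big /= -sumr_const; apply/eqP/eq_bigr => f fT.
rewrite (sum_incidence (fun z => side rat T f z - side rat T f x0)).
by rewrite opprB addrA subrK side_drop // eqxx.
Qed.

(** A spanning tree deprived of [f] becomes a spanning tree again by adding any
    edge whose ends are then disconnected. *)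
Lemma spanning_tree_exchange F f g :
  is_spanning_tree (f |: F) -> f \notin F ->
  ~~ connect (adj F) (end1 g) (end2 g) -> is_spanning_tree (g |: F).
Proof.
move=> tT fF cg; have gF : g \notin F by apply: contra cg => /connect_ends.
have [cT _] := tT.
have sub u v : connect (adj F) u v -> connect (adj (g |: F)) u v.
  by apply: connect_subset; apply: finset.subsetUr.
have cf1g : connect (adj (g |: F)) (end1 f) (end2 f).
  have gg : connect (adj (g |: F)) (end1 g) (end2 g).
    by apply: connect_ends; rewrite !inE eqxx.
  have via u v w : connect (adj F) u v -> connect (adj F) u w ->
      connect (adj F) v w.
    by rewrite connect_adjC => uv; apply: connect_trans uv.
  have /orP[] := two_components (end1 g) cT => c1;
    have /orP[] := two_components (end2 g) cT => c2.
  - by rewrite (via _ _ _ c1 c2) in cg.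
  - apply: connect_trans (sub _ _ c1) (connect_trans gg _).
    by rewrite connect_adjC; apply: sub.
  - rewrite connect_adjC.
    apply: connect_trans (sub _ _ c1) (connect_trans gg _).
    by rewrite connect_adjC; apply: sub.
  - by rewrite (via _ _ _ c1 c2) in cg.
have cgF : connected_by (g |: F).
  apply: connected_by_ends cT _ => h; rewrite finset.in_setU1.
  by case/predU1P=> [-> //|/connect_ends]; exact: sub.
(* A spanning tree inside [g |: F] has as many edges as [g |: F] itself. *)
have [T TgF tT'] := spanning_tree_inside cgF.
suff <- : T = g |: F by [].
apply/eqP; rewrite eqEcard TgF /= cardsU1 gF.
have := card_spanning_tree (end1 f) tT'.
by rewrite -(card_spanning_tree (end1 f) tT) cardsU1 fF => -[->].
Qed.

(** Spanning forests with exactly two components, encoded as spanning trees with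
    one edge removed. In a connected graph every such forest arises in this
    way. *)
Definition two_forest F : bool :=
  [exists f, (f \notin F) && `[< is_spanning_tree (f |: F) >]].

End TreeCount.

(** * Kirchhoff's theorem *)

Section Electric.
Variables (R : realType) (G : multigraph).
Implicit Types (A F T : {set edge G}) (e f g : edge G) (x y z : vertex G).

Lemma net_current_outE (v : vertex G -> R) z :
  net_current_out v z = \sum_e incidence R z e * (v (end1 e) - v (end2 e)).
Proof.
rewrite /net_current_out.
under eq_bigr do rewrite big_mkcond.
rewrite exchange_big; apply: eq_bigr => e _ /=.
rewrite -big_mkcond /incidence /=.
have e12 := negPf (loopless e).
have [<-|n1] /= := eqVneq (end1 e) z.
  rewrite eq_sym e12 subr0 mul1r (big_pred1 (end2 e)) // => w.
  by rewrite /joins eqxx (eq_sym (end2 e) (end1 e)) e12 andbF orbF /= eq_sym.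
have [<-|n2] /= := eqVneq (end2 e) z.
  rewrite sub0r mulN1r opprB (big_pred1 (end1 e)) // => w.
  by rewrite /joins eqxx e12 /= andbT eq_sym.
rewrite subrr mul0r big1 // => w.
by rewrite /joins (negPf n1) (negPf n2) andbF.
Qed.

(** The number of two-component spanning forests that separate [x] from [y] and
    in which [z] is on the side of [x]. *)
Definition forest_voltage x y z : R :=
  \sum_(F | two_forest F && ~~ connect (adj F) x y) (connect (adj F) x z)%:R.

(** Removing [f] from the spanning trees through [f] yields the two-component
    forests that separate the ends of [f]; the other forests do not contribute
    to the drop along [f]. *)
Lemma forest_voltage_drop x y f :
  forest_voltage x y (end1 f) - forest_voltage x y (end2 f) =
  \sum_(T | `[< is_spanning_tree T >] && (f \in T))
    (side R T f x - side R T f y).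
Proof.
rewrite -sumrB big_mkcond /=.
rewrite [RHS](reindex_onto (fun F => f |: F) (fun T => T :\ f)); last first.
  by move=> T /andP[_]; exact: finset.setD1K.
rewrite [RHS]big_mkcond /=; apply: eq_bigr => F _.
have [fF|fF] := boolP (f \in F).
  rewrite (connect_endsr _ fF) subrr if_same ifF //.
  apply/negP => /andP[_ /eqP FE].
  by move: fF; rewrite -FE !inE eqxx.
rewrite finset.setU1K // eqxx andbT finset.setU11 andbT /side finset.setU1K //.
have sym := @connect_adjC G F.
case: asboolP => tT; last first.
  (* A forest [F] separating the ends of [f] would contradict exchange. *)
  case: ifP => // /andP[/existsP[g /andP[gF /asboolP tg]] _].
  have [c12|c12] := boolP (connect (adj F) (end1 f) (end2 f)).
    by rewrite (same_connect_r sym c12) subrr.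
  by case: tT; exact: spanning_tree_exchange tg gF c12.
have -> : two_forest F by apply/existsP; exists f; rewrite fF; apply/asboolP.
have /is_spanning_treeP[cT brT] := tT.
have := brT f (finset.setU11 _ _); rewrite finset.setU1K // => /negPf c12 /=.
(* [F] has two components, those of the ends of [f]: compare the two summands
   according to the components of [x] and of [y]. *)
have := two_components x cT; have := two_components y cT.
have [c1x _ _|_ /= cy c2x] := boolP (connect (adj F) (end1 f) x).
  rewrite -!(same_connect sym c1x) connect0 c12.
  by case: (connect _ _ y); rewrite ?subrr ?subr0.
rewrite -!(same_connect sym c2x) connect0.
rewrite (sym (end2 f) (end1 f)) c12.
move: cy; have [c2y|c2y] := boolP (connect _ (end2 f) y); last first.
  by rewrite orbF => ->; rewrite sub0r.
by rewrite (sym _ y) -(same_connect sym c2y) (sym (end2 f)) c12 subrr.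
Qed.

(** A potential without sources is constant: its energy, the sum of the squares
    of its drops along the edges, is zero. *)
Lemma harmonic_constant (d : vertex G -> R) x y :
  connected_graph G -> (forall z, net_current_out d z = 0) -> d x = d y.
Proof.
move=> cG d0; apply: connect_invariant (cG x y) => e _.
have /psumr_eq0P dE : \sum_e (d (end1 e) - d (end2 e)) ^+ 2 = 0.
  transitivity (\sum_z d z * net_current_out d z).
    under [RHS]eq_bigr do rewrite net_current_outE mulr_sumr.
    rewrite exchange_big; apply: eq_bigr => f _ /=.
    rewrite expr2 -{1}(sum_incidence d f) mulr_suml.
    by apply: eq_bigr => z _; ring.
  by rewrite big1 // => z _; rewrite d0 mulr0.
apply/eqP; rewrite -subr_eq0 -sqrf_eq0 dE // => f _.
exact: sqr_ge0.
Qed.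

(** The effective resistance can be read off any voltage of the unit current. *)
Lemma effective_resistanceE x y (v : vertex G -> R) :
  connected_graph G -> unit_current_voltage x y v ->
  effective_resistance R x y = v x - v y.
Proof.
move=> cG vP; rewrite /effective_resistance.
set w := xget _ _; have wP : unit_current_voltage x y w.
  exact: (xgetPex (fun=> 0) (ex_intro (unit_current_voltage x y) v vP)).
have d0 z : net_current_out (fun z => w z - v z) z = 0.
  transitivity (net_current_out w z - net_current_out v z).
    rewrite !net_current_outE -sumrB.
    by apply: eq_bigr => e _; ring.
  by rewrite wP vP subrr.
have dE : w x - v x = w y - v y := harmonic_constant x y cG d0.
by rewrite -[w x](subrK (v x)) dE; ring.
Qed.

Lemma sum_spanning_tree (h : {set edge G} -> R) :
  \sum_(t : spanning_tree G) h (val t) =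
  \sum_(T | `[< is_spanning_tree T >]) h T.
Proof.
rewrite [RHS](reindex_omap (val : spanning_tree G -> _) insub) => [|T tT].
  by apply: eq_bigl => -[T tT] /=; rewrite insubT tT eqxx.
by rewrite insubT.
Qed.

Lemma card_spanning_trees_gt0 :
  connected_graph G -> (0 < #|spanning_tree G|)%N.
Proof.
case/spanning_tree_inside => T _ /asboolP tT.
by apply/card_gt0P; exists (exist _ T tT).
Qed.

(** The current is the average over the spanning trees [T] of the unit flows
    given by [tree_flow]. *)
Lemma forest_voltage_unit_current x y :
  connected_graph G ->
  unit_current_voltage x y
    (fun z => forest_voltage x y z / #|spanning_tree G|%:R).
Proof.
move=> cG z; have N0 : #|spanning_tree G|%:R != 0 :> R.
  by rewrite pnatr_eq0 -lt0n card_spanning_trees_gt0.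
set N := _%:R in N0 *.
transitivity (N^-1 * \sum_e \sum_(T | `[< is_spanning_tree T >] && (e \in T))
    incidence R z e * (side R T e x - side R T e y)).
  rewrite net_current_outE mulr_sumr; apply: eq_bigr => e _.
  by rewrite -mulr_sumr -forest_voltage_drop; ring.
rewrite (exchange_big_dep (fun T => `[< is_spanning_tree T >])) /=; last first.
  by move=> e T _ /andP[].
rewrite (eq_bigr (fun=> (x == z)%:R - (y == z)%:R)); last first.
  move=> T tT; rewrite -(@tree_flow _ _ T); last exact/asboolP.
  by apply: eq_bigl => e; rewrite tT.
rewrite -(sum_spanning_tree (fun=> _)) sumr_const -[_ *+ _]mulr_natl mulKf //.
by rewrite ![z == _]eq_sym.
Qed.

Definition uniform_tree_pmf (t : spanning_tree G) : R :=
  #|spanning_tree G|%:R^-1.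

Lemma uniform_tree_pmfP : connected_graph G -> pmf uniform_tree_pmf.
Proof.
move=> cG; split=> [t|]; first by rewrite invr_ge0 ler0n.
rewrite sumr_const -[_ *+ _]mulr_natl divff //.
by rewrite pnatr_eq0 -lt0n card_spanning_trees_gt0.
Qed.

(** Kirchhoff's theorem: the effective resistance of [e] is the probability that
    a uniform spanning tree contains [e]. *)
Lemma kirchhoff_Reff e :
  connected_graph G -> Reff R e = Defs.eta uniform_tree_pmf e.
Proof.
move=> cG.
rewrite /Reff (effective_resistanceE cG (forest_voltage_unit_current _ _ cG)).
rewrite -mulrBl forest_voltage_drop /Defs.eta /uniform_tree_pmf -mulr_suml.
congr (_ / _).
rewrite (sum_spanning_tree (fun T => (e \in T)%:R)) big_mkcondr /=.
apply: eq_bigr => T /asboolP tT; case: ifP => // eT.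
by rewrite side_drop // eqxx.
Qed.

(** * The edge usage of a pmf on spanning trees *)

Lemma sum_eta (mu : spanning_tree G -> R) (x0 : vertex G) :
  \sum_e Defs.eta mu e = (#|vertex G|%:R - 1) * \sum_t mu t.
Proof.
rewrite exchange_big mulr_sumr; apply: eq_bigr => t _ /=.
rewrite -mulr_suml; congr (_ * _).
have /asboolP tT := valP t; rewrite -(card_spanning_tree x0 tT) -natr1 addrK.
by rewrite -natr_sum -big_mkcond sum1_card.
Qed.

Lemma eta_ge0 (mu : spanning_tree G -> R) e :
  (forall t, 0 <= mu t) -> 0 <= Defs.eta mu e.
Proof. by move=> mu0; apply: sumr_ge0 => t _; rewrite mulr_ge0 ?ler0n. Qed.

Lemma card_vertex_sub1_gt0 e : 0 < #|vertex G|%:R - 1 :> R.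
Proof.
rewrite subr_gt0 ltr1n; apply/card_gt1P.
by exists (end1 e), (end2 e); rewrite loopless.
Qed.

Lemma pmf_eta (mu : spanning_tree G -> R) e :
  pmf mu -> pmf (fun f => Defs.eta mu f / (#|vertex G|%:R - 1)).
Proof.
move=> [mu0 mu1]; have n0 := card_vertex_sub1_gt0 e; split=> [f|].
  by rewrite divr_ge0 ?eta_ge0 // ltW.
by rewrite -mulr_suml (sum_eta _ (end1 e)) mu1 mulr1 divff ?gt_eqF.
Qed.

End Electric.

Theorem theorem3p9 (R : realType) (G : multigraph)
    (G_connected : connected_graph G) (G_edge : (0 < #|edge G|)%N) :
  (forall mu : spanning_tree G -> R, pmf mu ->
     (forall e : edge G, exists t : spanning_tree G, 0 < mu t /\ e \in val t) ->
     exists beta : edge G -> R, positive_pmf beta /\ in_U beta mu) /\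
  (exists beta : edge G -> R, pmf beta /\ proportional beta (@Reff R G)) /\
  (forall beta : edge G -> R, pmf beta -> proportional beta (@Reff R G) ->
     homogeneous beta).
Proof.
have /card_gt0P[e0 _] := G_edge.
have n0 := card_vertex_sub1_gt0 R e0; have nN0 := lt0r_neq0 n0.
set n := (_ - 1) in n0 nN0.
have RE e : Reff R e = Defs.eta (@uniform_tree_pmf R G) e.
  exact: kirchhoff_Reff.
have uP := uniform_tree_pmfP R G_connected.
split; [|split].
- move=> mu muP mu_e; have [mu0 mu1] := muP.
  exists (fun e => Defs.eta mu e / n); split; first split.
  + exact: pmf_eta.
  + move=> e; have [t [t0 et]] := mu_e e; rewrite divr_gt0 //.
    rewrite /Defs.eta (bigD1 t) //= /usage et mul1r ltr_wpDr //.
    by apply: sumr_ge0 => s _; rewrite mulr_ge0 ?ler0n.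
  + by split=> // e; rewrite -/n mu1 mulr1 mulrC divfK.
- exists (fun e => Defs.eta (@uniform_tree_pmf R G) e / n); split.
    exact: pmf_eta.
  by exists n^-1 => e; rewrite RE mulrC.
- move=> beta [_ beta1] [c betaE]; exists (@uniform_tree_pmf R G); split=> // e.
  (* [Reff] has total mass [n] and [beta] has total mass 1. *)
  have cn : c * n = 1.
    rewrite -beta1; under eq_bigr do rewrite betaE RE.
    by rewrite -mulr_sumr (sum_eta _ (end1 e0)) uP.2 mulr1.
  by rewrite betaE RE -/n -[c](mulfK nN0) cn mul1r mulrC.
Qed.
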